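(* Consider the max-margin Markov network training problem and the sequences $\{w_k\}$, $\{\alpha_k\}$ produced by the algorithm described in the context. Let $\alpha^*=\operatorname{argmax}_{\alpha\in\mathcal S^n}D(\alpha)$, let $\alpha_0$ be the uniform distribution (all entries $\frac1{n|\mathcal Y|}$), and let $\mathrm{KL}(p\|q)=\sum_j p_j\ln\frac{p_j}{q_j}$. Then for every $k\ge1$, $$J(w_k)-D(\alpha_k)\le\frac{6\log|\mathcal Y|}{(k+1)(k+2)}\cdot\frac{\max_{i,y}\|\psi^i_y\|^2}{\lambda}$$ and $$\max_{\alpha\in\mathcal S^n}D(\alpha)-D(\alpha_k)\le\frac{6\,\mathrm{KL}(\alpha^*\|\alpha_0)}{(k+1)(k+2)}\cdot\frac{\max_{i,y}\|\psi^i_y\|^2}{\lambda}.$$ Therefore, to reduce the duality gap $J(w_k)-D(\alpha_k)$ below $\epsilon$ it suffices to take $2+\max_{i,y}\|\psi^i_y\|\sqrt{\frac{6\log|\mathcal Y|}{\lambda\epsilon}}$ steps, and to reduce the dual gap $\max_{\alpha\in\mathcal S^n}D(\alpha)-D(\alpha_k)$ below $\epsilon$ it suffices to take $2+\max_{i,y}\|\psi^i_y\|\sqrt{\frac{6\,\mathrm{KL}(\alpha^*\|\alpha_0)}{\lambda\epsilon}}$ steps.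
   Context: Data. There are $n$ labeled data points $(x^i,y^i)$, $i=1,\dots,n$, with $x^i$ in a space $\mathcal X$ and $y^i$ in a label space $\mathcal Y$ with $|\mathcal Y|$ elements; a feature map $\phi$ sends $(x,y)$ to $\phi(x,y)\in\mathbb R^p$; $\ell^i_y=\ell(y,y^i;x^i)$ is the loss of predicting label $y$ when the correct label of $x^i$ is $y^i$; $\lambda>0$ is a regularization parameter; $\epsilon>0$ is the accuracy. Put $\psi^i_y:=\phi(x^i,y^i)-\phi(x^i,y)$, and let $\|\cdot\|$ be the Euclidean norm. Primal objective: $J(w)=\frac\lambda2\|w\|^2+\frac1n\sum_{i=1}^n\max_{y\in\mathcal Y}\{\ell^i_y-\langle w,\psi^i_y\rangle\}$, $w\in\mathbb R^p$. Dual domain: $\mathcal S^n=\{\alpha\in[0,1]^{n|\mathcal Y|}:\sum_{y}\alpha^i_y=\frac1n\ \forall i\}$. Dual objective: $D(\alpha)=-\frac1{2\lambda}\alpha^\top AA^\top\alpha+\sum_{i}\sum_y\ell^i_y\alpha^i_y$, $\alpha\in\mathcal S^n$, where $A$ is the $(n|\mathcal Y|)$-by-$p$ matrix whose $(i,y)$-th row is $(-\psi^i_y)^\top$. Prox-function: $d(\alpha)=\sum_{i}\sum_{y}\alpha^i_y\log\alpha^i_y+\log n+\log|\mathcal Y|$ on $\mathcal S^n$ (relative entropy with respect to the uniform distribution), whose minimizer over $\mathcal S^n$ is $\alpha_0$. The norm used on the dual space is the $L_1$ norm and that on $\mathbb R^p$ is the $L_2$ norm; $d$ is 1-strongly convex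 on $\mathcal S^n$ with respect to the $L_1$ norm. Maps: $w(\alpha)=-\frac1\lambda A^\top\alpha=\frac1\lambda\sum_{i}\sum_y\alpha^i_y\psi^i_y$; $(\nabla D(\alpha))^i_y=\ell^i_y-\langle\psi^i_y,w(\alpha)\rangle$; for $\mu>0$, $$(\alpha_\mu(w))^i_y=\frac1n\,\frac{\exp(\mu^{-1}(\ell^i_y-\langle\psi^i_y,w\rangle))}{\sum_{y'}\exp(\mu^{-1}(\ell^i_{y'}-\langle\psi^i_{y'},w\rangle))},\qquad (V(\alpha,u))^i_y=\frac1n\,\frac{\alpha^i_y\exp(-u^i_y)}{\sum_{y'}\alpha^i_{y'}\exp(-u^i_{y'})},$$ where $V$ is the Bregman projection associated with $d$. Algorithm. $\mu_1=\frac1\lambda\max_{i,y}\|\psi^i_y\|^2$, $w_1=w(\alpha_0)$, $\alpha_1=V(\alpha_0,-\frac1{\mu_1}\nabla D(\alpha_0))$. For $k=1,2,\dots$ set $\tau_k=\frac2{k+3}$ and $\hat\alpha=(1-\tau_k)\alpha_k+\tau_k\alpha_{\mu_k}(w_k)$; $w_{k+1}=(1-\tau_k)w_k+\tau_kw(\hat\alpha)$; $\tilde\alpha=V\big(\alpha_{\mu_k}(w_k),\frac{-\tau_k}{(1-\tau_k)\mu_k}\nabla D(\hat\alpha)\big)$; $\alpha_{k+1}=(1-\tau_k)\alpha_k+\tau_k\tilde\alpha$; $\mu_{k+1}=(1-\tau_k)\mu_k$. *)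

(* Defs.v *)
From mathcomp Require Export all_boot all_order all_algebra.
From mathcomp Require Export all_classical all_reals all_analysis.

Set Implicit Arguments.
Unset Strict Implicit.
Unset Printing Implicit Defensive.

Import Order.TTheory GRing.Theory Num.Theory.

Local Open Scope classical_set_scope.
Local Open Scope ring_scope.

(* The library norm on matrices is the sup norm, hence a Euclidean norm here. *)
Definition dotp (R : realType) (p : nat) (u v : 'cV[R]_p) : R :=
  \sum_(j < p) u j 0 * v j 0.

Definition enorm (R : realType) (p : nat) (u : 'cV[R]_p) : R :=
  Num.sqrt (dotp u u).

(* [loss y y' x] is the loss l(y, y'; x) of predicting [y] on [x] when the
   correct label is [y']. *)
Record m3n (R : realType) (n p : nat) (X : Type) (Y : finType) := M3N {
  point : 'I_n -> X;
  label : 'I_n -> Y;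
  feature : X -> Y -> 'cV[R]_p;
  loss : Y -> Y -> X -> R;
  lambda : R }.

Section MaxMarginMarkovNetwork.
Context {R : realType} {n p : nat} {X : Type} {Y : finType}.
Variable P : m3n R n p X Y.

Local Notation lam := (lambda P).

Definition ell (i : 'I_n) (y : Y) : R := loss P y (label P i) (point P i).

Definition psi (i : 'I_n) (y : Y) : 'cV[R]_p :=
  feature P (point P i) (label P i) - feature P (point P i) y.

(* Norms are nonnegative, so the default value 0 does not affect the maximum. *)
Definition psi_max : R :=
  \big[Num.max/0]_(c : 'I_n * Y) enorm (psi c.1 c.2).

(* The term of the true label, itself one of the terms, is used as the default
   value of the maximum over [Y]. *)
Definition J (w : 'cV[R]_p) : R :=
  let margin i y := ell i y - dotp w (psi i y) in
  lam / 2 * enorm w ^+ 2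
  + n%:R^-1 * \sum_(i < n) \big[Num.max/margin i (label P i)]_(y : Y) margin i y.

Definition dual : Type := 'I_n -> Y -> R.

Definition Sn : set dual :=
  [set a | (forall i y, 0 <= a i y <= 1)
           /\ (forall i, \sum_(y : Y) a i y = n%:R^-1)].

(* Rows are indexed by ['I_n * Y] through its canonical enumeration. *)
Definition A : 'M[R]_(#|{: 'I_n * Y}|, p) :=
  \matrix_(r, j) - psi (enum_val r).1 (enum_val r).2 j 0.

Definition dual_vec (a : dual) : 'cV[R]_#|{: 'I_n * Y}| :=
  \col_r a (enum_val r).1 (enum_val r).2.

Definition D (a : dual) : R :=
  - (2 * lam)^-1 * ((dual_vec a)^T *m A *m A^T *m dual_vec a) 0 0
  + \sum_(i < n) \sum_(y : Y) ell i y * a i y.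

Definition is_argmaxD (a : dual) : Prop :=
  Sn a /\ forall b, Sn b -> D b <= D a.

Definition maxD : R := sup (D @` Sn).

Definition alpha0 : dual := fun _ _ => (n%:R * #|Y|%:R)^-1.

(* The convention 0 ln(0/q) = 0 holds because of the factor [a i y]. *)
Definition KL (a b : dual) : R :=
  \sum_(i < n) \sum_(y : Y) a i y * ln (a i y / b i y).

Definition w_of (a : dual) : 'cV[R]_p := - lam^-1 *: (A^T *m dual_vec a).

Definition gradD (a : dual) : dual :=
  fun i y => ell i y - dotp (psi i y) (w_of a).

Definition alpha_mu (mu : R) (w : 'cV[R]_p) : dual :=
  let e i y := expR (mu^-1 * (ell i y - dotp (psi i y) w)) in
  fun i y => n%:R^-1 * (e i y / \sum_(y' : Y) e i y').

Definition V (a u : dual) : dual :=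
  let e i y := a i y * expR (- u i y) in
  fun i y => n%:R^-1 * (e i y / \sum_(y' : Y) e i y').

Definition scale_dual (c : R) (a : dual) : dual := fun i y => c * a i y.

Definition mix_dual (t : R) (a b : dual) : dual :=
  fun i y => (1 - t) * a i y + t * b i y.

Record state := State { st_mu : R; st_w : 'cV[R]_p; st_alpha : dual }.

Definition init : state :=
  let mu1 := lam^-1 * psi_max ^+ 2 in
  State mu1 (w_of alpha0) (V alpha0 (scale_dual (- mu1^-1) (gradD alpha0))).

Definition tau (k : nat) : R := 2 / (k + 3)%:R.

Definition step (k : nat) (s : state) : state :=
  let: State mu w a := s in
  let t := tau k in
  let amu := alpha_mu mu w in
  let ahat := mix_dual t a amu in
  let atilde := V amu (scale_dual (- t / ((1 - t) * mu)) (gradD ahat)) in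
  State ((1 - t) * mu)
        ((1 - t) *: w + t *: w_of ahat)
        (mix_dual t a atilde).

(* Indexed from 1: [iterate 1 = init] and
   [iterate k.+1 = step k (iterate k)] for k >= 1. *)
Definition iterate (k : nat) : state :=
  iteri k.-1 (fun j => step j.+1) init.

Definition w_seq (k : nat) : 'cV[R]_p := st_w (iterate k).

Definition alpha_seq (k : nat) : dual := st_alpha (iterate k).

End MaxMarginMarkovNetwork.

(* Main.v *)
Require Import Defs.
From mathcomp Require Import ring lra.

(**
The iterates keep Nesterov's excessive gap condition [J_mu_k w_k <= D alpha_k],
where [J_mu] is the primal objective with its maximum over the dual domain
smoothed by [mu] times the relative entropy [d]. As [0 <= d <= ln #|Y|] and
[mu_k = 6 / ((k + 1) (k + 2)) * psi_max ^ 2 / lambda], evaluating the smoothed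
maximum at a maximizer for [J w_k] gives the duality gap, and evaluating it at
[alpha^*] gives the dual gap, since [d alpha^* = KL alpha^* alpha0].

The step works because the smoothed inner problem is an exact Bregman problem:
its value at [b] falls short of the optimum by exactly [mu] times the relative
entropy of [b] with respect to the optimizer. The error made when moving in the
dual is quadratic in the [L_1] norm, with constant [psi_max ^ 2 / lambda], and
Pinsker's inequality absorbs it into that entropy because
[tau_k ^ 2 * mu_1 <= (1 - tau_k) mu_k].
*)

Set Implicit Arguments.
Unset Strict Implicit.
Unset Printing Implicit Defensive.

Import Order.TTheory GRing.Theory Num.Theory.

Local Open Scope ring_scope.

(** * Pinsker's inequality from a rational lower bound on the logarithm *)

Lemma is_derive_ln_pade (R : realType) (x : R) : 0 < x ->
  is_derive x 1 (fun y : R => ln y + 4^-1 * y^-1 + 27 / 4 * (y + 2)^-1)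
    (x^-1 - 4^-1 * x ^- 2 - 27 / 4 * (x + 2) ^- 2).
Proof.
move=> x0.
have ln' := is_derive1_ln x0.
have inv' : is_derive x 1 (fun y : R => y^-1) (- x ^- 2 *: (1 : R)).
  by apply: is_deriveV; rewrite gt_eqF.
have inv2' : is_derive x 1 (fun y : R => (y + 2)^-1) (- (x + 2) ^- 2 *: (1 + 0 : R)).
  by apply: (@is_deriveV R (fun y => y + 2)); rewrite gt_eqF // addr_gt0.
apply: is_derive_eq => /=.
rewrite /GRing.scale /=; ring.
Qed.

(* The difference of the two sides has derivative [(t - 1) ^ 3 / (t (t + 2)) ^ 2]
   and vanishes at [1]. *)
Lemma ln_ge_pade (R : realType) (t : R) : 0 < t ->
  5 / 2 - 4^-1 * t^-1 - 27 / 4 * (t + 2)^-1 <= ln t.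
Proof.
move=> t0.
pose f (y : R) : R := ln y + 4^-1 * y^-1 + 27 / 4 * (y + 2)^-1.
pose df (x : R) : R := x^-1 - 4^-1 * x ^- 2 - 27 / 4 * (x + 2) ^- 2.
have f1 : f 1 = 5 / 2.
  by rewrite /f ln1; field.
have f'E (x : R) : 0 < x -> df x = (x - 1) ^+ 3 / (x ^+ 2 * (x + 2) ^+ 2).
  by move=> x0; rewrite /df; field; apply/andP; split; rewrite gt_eqF //; lra.
have den0 (x : R) : 0 < x -> 0 <= (x ^+ 2 * (x + 2) ^+ 2)^-1.
  by move=> x0; rewrite invr_ge0 mulr_ge0 // sqr_ge0.
have mvt (a b : R) : 0 < a -> a < b ->
    exists2 c, c \in `]a, b[ & f b - f a = df c * (b - a).
  move=> a0 ab; apply: MVT => //.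
    move=> x; rewrite in_itv /= => /andP[ax _].
    by apply: is_derive_ln_pade; exact: lt_trans ax.
  apply: derivable_within_continuous => x; rewrite in_itv /= => /andP[ax _].
  have x0 : 0 < x := lt_le_trans a0 ax.
  by have [] := is_derive_ln_pade x0.
suff : f 1 <= f t by rewrite f1 /f; lra.
case: (ltgtP t 1) => [t1|t1|->] //.
- have [c] := mvt _ _ t0 t1; rewrite in_itv /= => /andP[tc c1] E.
  have c0 : 0 < c by exact: lt_trans tc.
  suff : df c * (1 - t) <= 0 by lra.
  rewrite f'E //; apply: mulr_le0_ge0; last by rewrite subr_ge0 ltW.
  apply: mulr_le0_ge0; last exact: den0.
  by rewrite exprSr mulr_ge0_le0 ?sqr_ge0 // subr_le0 ltW.
- have [c] := mvt _ _ ltr01 t1; rewrite in_itv /= => /andP[c1 ct] E.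
  have c0 : 0 < c by exact: lt_trans c1.
  suff : 0 <= df c * (t - 1) by lra.
  rewrite f'E //; apply: mulr_ge0; last by rewrite subr_ge0 ltW.
  apply: mulr_ge0; last exact: den0.
  by rewrite exprn_ge0 // subr_ge0 ltW.
Qed.

(** At [t = a / b] the rational bound of [ln_ge_pade] turns the right-hand side into exactly
    [(a - b) ^ 2]; the case [a = 0] is checked directly. *)
Lemma pinsker_term (R : realType) (a b : R) : 0 <= a -> 0 < b ->
  (a - b) ^+ 2 <= (2 * a + 4 * b) / 3 * (a * ln (a / b) - a + b).
Proof.
rewrite le_eqVlt => /orP[/eqP<-|a0] b0.
  by rewrite mul0r; nra.
have u0 : 0 < 2 * a + 4 * b by lra.
have := ln_ge_pade (divr_gt0 a0 b0); set L := ln _ => Lge.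
have {}Lge : a * (5 / 2 - 4^-1 * (a / b)^-1 - 27 / 4 * (a / b + 2)^-1) <= a * L.
  by rewrite ler_pM2l.
have -> : (a - b) ^+ 2 = (2 * a + 4 * b) / 3 *
    (a * (5 / 2 - 4^-1 * (a / b)^-1 - 27 / 4 * (a / b + 2)^-1) - a + b).
  by field; rewrite !gt_eqF //=; lra.
by rewrite ler_pM2l; lra.
Qed.

(* [x ^ 2 <= u v] gives [S |x| <= S ^ 2 u / 4 + v]; the [u] sum to [2] and the
   [v] to the relative entropy, so summing with [S] the [L_1] distance suffices. *)
Lemma pinsker (R : realType) (T : finType) (a b : T -> R) :
  (forall c, 0 <= a c) -> (forall c, 0 < b c) ->
  \sum_c a c = 1 -> \sum_c b c = 1 ->
  (\sum_c `|a c - b c|) ^+ 2 <= 2 * \sum_c a c * ln (a c / b c).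
Proof.
move=> a0 b0 suma sumb.
set S := \sum_c `|_|; set K := \sum_c _ * _.
have term c : S * `|a c - b c|
    <= S ^+ 2 / 4 * ((2 * a c + 4 * b c) / 3) + (a c * ln (a c / b c) - a c + b c).
  have := pinsker_term (a0 c) (b0 c); have u0 : 0 < (2 * a c + 4 * b c) / 3.
    by have := a0 c; have := b0 c; lra.
  rewrite -(real_normK (num_real (a c - b c))).
  move: (_ / 3) (_ - _ + _) `|_| u0 => u v x u0 xuv.
  have v0 : 0 <= v by rewrite -(pmulr_rge0 _ u0); apply: le_trans xuv; exact: sqr_ge0.
  have r0 : 0 <= S ^+ 2 / 4 * u + v.
    by rewrite addr_ge0 // mulr_ge0 ?(ltW u0) // divr_ge0 ?sqr_ge0.
  (* Squares are compared: [S ^ 2 x ^ 2 <= S ^ 2 u v], and the latter is at most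
     [(S ^ 2 u / 4 + v) ^ 2] by the arithmetic-geometric mean inequality. *)
  apply: le_trans (ler_norm _) _; rewrite -(ger0_norm r0) -ler_sqr ?nnegrE //.
  rewrite !real_normK ?num_real // exprMn.
  have := ler_wpM2l (sqr_ge0 S) xuv; have := sqr_ge0 (S ^+ 2 / 4 * u - v).
  lra.
have := ler_sum (index_enum T) (P := xpredT) (fun c _ => term c).
rewrite -mulr_sumr -/S !big_split /= sumrN -mulr_sumr -mulr_suml big_split /=.
rewrite -!mulr_sumr suma sumb -/K.
lra.
Qed.

(** * Euclidean inner product *)

Section EuclideanVectors.
Context {R : realType} {p : nat}.
Implicit Types u v w : 'cV[R]_p.

Lemma dotpE u v : dotp u v = (u^T *m v) 0 0.
Proof. by rewrite mxE; apply: eq_bigr => j _; rewrite mxE. Qed.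

Lemma dotpC u v : dotp u v = dotp v u.
Proof. by apply: eq_bigr => j _; rewrite mulrC. Qed.

Lemma dotpDl u v w : dotp (u + v) w = dotp u w + dotp v w.
Proof. by rewrite -big_split; apply: eq_bigr => j _; rewrite mxE mulrDl. Qed.

Lemma dotpZl (c : R) u v : dotp (c *: u) v = c * dotp u v.
Proof. by rewrite mulr_sumr; apply: eq_bigr => j _; rewrite mxE mulrA. Qed.

Lemma dotpBl u v w : dotp (u - v) w = dotp u w - dotp v w.
Proof. by rewrite dotpDl -scaleN1r dotpZl mulN1r. Qed.

Lemma dotpDr u v w : dotp w (u + v) = dotp w u + dotp w v.
Proof. by rewrite dotpC dotpDl !(dotpC w). Qed.

Lemma dotpZr (c : R) u v : dotp v (c *: u) = c * dotp v u.
Proof. by rewrite dotpC dotpZl dotpC. Qed.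

Lemma dotpBr u v w : dotp w (u - v) = dotp w u - dotp w v.
Proof. by rewrite dotpC dotpBl !(dotpC w). Qed.

Lemma dotp_sumr (I : finType) (F : I -> 'cV[R]_p) v :
  dotp v (\sum_i F i) = \sum_i dotp v (F i).
Proof.
rewrite exchange_big /=; apply: eq_bigr => j _.
by rewrite summxE mulr_sumr.
Qed.

Lemma dotp_ge0 u : 0 <= dotp u u.
Proof. by apply: sumr_ge0 => j _; rewrite -expr2 sqr_ge0. Qed.

Lemma enorm_sqr u : enorm u ^+ 2 = dotp u u.
Proof. by rewrite sqr_sqrtr // dotp_ge0. Qed.

(** With a common bound on both squared norms, expanding the squared norms of [u + v] and [u - v]
    does the work of Cauchy-Schwarz. *)
Lemma dotp_norm_le (m : R) u v :
  dotp u u <= m -> dotp v v <= m -> `|dotp u v| <= m.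
Proof.
move=> um vm; rewrite ler_norml.
have := dotp_ge0 (u + v); have := dotp_ge0 (u - v).
rewrite dotpBl dotpDl !dotpBr !dotpDr (dotpC v u); lra.
Qed.

End EuclideanVectors.

(** * Relative entropy and Bregman projections on the dual domain *)

Section DualVectors.
Context {R : realType} {n : nat} {Y : finType}.
Implicit Types a b u q s : 'I_n -> Y -> R.

Definition dpair u a : R := \sum_(i < n) \sum_(y : Y) u i y * a i y.

Lemma dpairBr u a b : dpair u (fun i y => a i y - b i y) = dpair u a - dpair u b.
Proof.
rewrite /dpair -sumrB; apply: eq_bigr => i _.
rewrite -sumrB; apply: eq_bigr => y _; ring.
Qed.

Lemma dpair_mix u a b (t : R) :
  dpair u (mix_dual t a b) = (1 - t) * dpair u a + t * dpair u b.
Proof.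
rewrite /dpair !mulr_sumr -big_split; apply: eq_bigr => i _.
rewrite !mulr_sumr -big_split; apply: eq_bigr => y _ /=; rewrite /mix_dual; ring.
Qed.

Lemma dpairZr (c : R) u a : dpair u (scale_dual c a) = c * dpair u a.
Proof.
rewrite /dpair !mulr_sumr; apply: eq_bigr => i _.
rewrite !mulr_sumr; apply: eq_bigr => y _; rewrite /scale_dual; ring.
Qed.

Lemma dpairZl (c : R) u a : dpair (scale_dual c u) a = c * dpair u a.
Proof.
rewrite /dpair !mulr_sumr; apply: eq_bigr => i _.
rewrite !mulr_sumr; apply: eq_bigr => y _; rewrite /scale_dual; ring.
Qed.

Lemma dpairBl u v a : dpair (fun i y => u i y - v i y) a = dpair u a - dpair v a.
Proof.
rewrite /dpair -sumrB; apply: eq_bigr => i _.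
rewrite -sumrB; apply: eq_bigr => y _; ring.
Qed.

Definition simplices a : Prop :=
  (forall i y, 0 <= a i y) /\ (forall i, \sum_(y : Y) a i y = n%:R^-1).

Definition positive a : Prop := forall i y, 0 < a i y.

Lemma Sn_simplices a : Sn a -> simplices a.
Proof. by case=> a01 suma; split=> // i y; case/andP: (a01 i y). Qed.

Lemma KLxx a : positive a -> KL a a = 0.
Proof.
move=> a0; rewrite /KL big1 // => i _; rewrite big1 // => y _.
by rewrite divff ?gt_eqF // ln1 mulr0.
Qed.

Lemma alpha0_gt0 : (0 < n)%N -> positive (@alpha0 R n Y).
Proof.
move=> n0 i y; rewrite invr_gt0 mulr_gt0 // ltr0n //.
by apply/card_gt0P; exists y.
Qed.

Lemma V_partition_gt0 q u (i : 'I_n) (y : Y) : positive q ->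
  0 < \sum_(y' : Y) q i y' * expR (- u i y').
Proof.
move=> q0; rewrite (bigD1 y) //= ltr_pwDl ?mulr_gt0 ?expR_gt0 //.
by apply: sumr_ge0 => z _; rewrite mulr_ge0 ?expR_ge0 // ltW.
Qed.

Lemma V_gt0 q u : (0 < n)%N -> positive q -> positive (V q u).
Proof.
move=> n0 q0 i y.
by rewrite mulr_gt0 ?invr_gt0 ?ltr0n // divr_gt0 ?V_partition_gt0 // mulr_gt0 ?expR_gt0.
Qed.

Lemma V_simplices q u : (0 < n)%N -> (0 < #|Y|)%N -> positive q ->
  simplices (V q u).
Proof.
move=> n0 /card_gt0P[y0 _] q0; split=> [i y|i].
  by rewrite ltW //; exact: V_gt0.
by rewrite /V -mulr_sumr -mulr_suml divff ?mulr1 // gt_eqF // V_partition_gt0.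
Qed.

(* Both sides differ from [KL b (V q u)] by the same log-partition function,
   which does not depend on [b]. *)
Lemma KL_V q u b : (0 < n)%N -> (0 < #|Y|)%N -> positive q -> simplices b ->
  dpair u b + KL b q = dpair u (V q u) + KL (V q u) q + KL b (V q u).
Proof.
move=> n0 Y0 q0 b0; have /card_gt0P[y0 _] := Y0.
pose Z i := \sum_(y : Y) q i y * expR (- u i y).
have Z0 i : 0 < Z i by exact: V_partition_gt0.
have n0' : 0 < n%:R^-1 :> R by rewrite invr_gt0 ltr0n.
pose C := \sum_(i < n) n%:R^-1 * (ln n%:R^-1 - ln (Z i)).
suff E a : simplices a -> dpair u a + KL a q - KL a (V q u) = C.
  have := E _ b0; rewrite -(E (V q u)) ?KLxx; first lra.
    exact: V_gt0.
  exact: V_simplices.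
case=> a0 suma; rewrite /dpair /KL -big_split -sumrB; apply: eq_bigr => i _ /=.
rewrite -(suma i) mulr_suml -big_split -sumrB; apply: eq_bigr => y _ /=.
have := a0 i y; rewrite le_eqVlt => /orP[/eqP<-|ay]; first by rewrite !mul0r; ring.
have s0 : 0 < V q u i y by exact: V_gt0.
rewrite !ln_div ?posrE // /V -/(Z i).
rewrite lnM ?posrE ?divr_gt0 ?mulr_gt0 ?expR_gt0 //.
rewrite ln_div ?posrE ?mulr_gt0 ?expR_gt0 // lnM ?posrE ?expR_gt0 // expRK suma.
ring.
Qed.

Definition l1norm a : R := \sum_(i < n) \sum_(y : Y) `|a i y|.

(** The [n] rows each sum to [1 / n], so a dual point is a single probability vector on ['I_n * Y],
    to which [pinsker] applies. *)
Lemma KL_pinsker a b : (0 < n)%N -> simplices a -> simplices b -> positive b ->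
  l1norm (fun i y => a i y - b i y) ^+ 2 <= 2 * KL a b.
Proof.
move=> n0 [a0 suma] [_ sumb] b0.
have sum1 (c : 'I_n -> Y -> R) : (forall i, \sum_(y : Y) c i y = n%:R^-1) ->
    \sum_(z : 'I_n * Y) c z.1 z.2 = 1.
  move=> sumc; rewrite -(pair_bigA _ c) /=.
  under eq_bigr => i _ do rewrite sumc.
  by rewrite sumr_const card_ord -(mulr_natr n%:R^-1) mulVf // pnatr_eq0 -lt0n.
rewrite /l1norm /KL !pair_bigA /=.
by apply: (pinsker (a := fun c => a c.1 c.2) (b := fun c => b c.1 c.2)) => //;
  exact: sum1.
Qed.

Lemma KL_ge0 a b : (0 < n)%N -> simplices a -> simplices b -> positive b ->
  0 <= KL a b.
Proof.
move=> n0 sa sb b0; have := KL_pinsker n0 sa sb b0.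
have := sqr_ge0 (l1norm (fun i y => a i y - b i y)); lra.
Qed.

End DualVectors.

(** * The excessive gap condition along the iterates, and its consequences *)

Section ExcessiveGap.
Context {R : realType} {n p : nat} {X : Type} {Y : finType}.
Variable P : m3n R n p X Y.
Hypothesis lambda_gt0 : 0 < lambda P.

Local Notation lam := (lambda P).
Implicit Types (a b h : @dual R n Y) (w : 'cV[R]_p).

Let lam_neq0 : lam != 0. Proof. by rewrite gt_eqF. Qed.

Definition margin w : @dual R n Y := fun i y => ell P i y - dotp (psi P i y) w.

(** Up to the factor [lam], [w_of] is the adjoint of the map sending [w] to its products with all
    [psi]. *)
Lemma dotp_w_of a w : lam * dotp w (w_of P a) = dpair (fun i y => dotp (psi P i y) w) a.
Proof.
have -> : w_of P a = lam^-1 *: \sum_(c : 'I_n * Y) a c.1 c.2 *: psi P c.1 c.2.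
  apply/matrixP => j k; rewrite (ord1 k) !mxE summxE mulNr -mulrN -sumrN.
  congr (_ * _); rewrite (big_enum_val _ (A := [pred _ : 'I_n * Y | true])) /=.
  by apply: eq_bigr => r _; rewrite !mxE; ring.
rewrite dotpZr mulrA divff // mul1r dotp_sumr /dpair [RHS]pair_bigA.
by apply: eq_bigr => c _; rewrite dotpZr mulrC dotpC.
Qed.

Lemma dpair_margin w a : dpair (margin w) a = dpair (ell P) a - lam * dotp w (w_of P a).
Proof. by rewrite dpairBl dotp_w_of. Qed.

Lemma w_ofB a b : w_of P (fun i y => a i y - b i y) = w_of P a - w_of P b.
Proof.
rewrite /w_of -scalerBr -mulmxBr; congr (_ *: (_ *m _)).
by apply/matrixP => i j; rewrite !mxE.
Qed.

Lemma DE a : D P a = dpair (ell P) a - lam / 2 * dotp (w_of P a) (w_of P a).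
Proof.
rewrite /D /w_of dotpZl dotpZr dotpE trmx_mul trmxK mulmxA addrC.
by congr (_ + _); rewrite mulrA mulrA -mulNr; congr (_ * _); field.
Qed.

(** [D] is quadratic, so its second-order Taylor expansion is exact. *)
Lemma D_expand a h : D P a = D P h + dpair (gradD P h) (fun i y => a i y - h i y)
  - lam / 2 * dotp (w_of P (fun i y => a i y - h i y)) (w_of P (fun i y => a i y - h i y)).
Proof.
have -> : gradD P h = margin (w_of P h) by [].
rewrite dpairBr !dpair_margin !DE w_ofB dotpBl !dotpBr (dotpC (w_of P h) (w_of P a)).
by field.
Qed.

Lemma psi_sqr_le i y : dotp (psi P i y) (psi P i y) <= psi_max P ^+ 2.
Proof.
rewrite -enorm_sqr ler_sqr ?nnegrE ?sqrtr_ge0 //.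
  exact: (le_bigmax _ (fun c : 'I_n * Y => enorm (psi P c.1 c.2)) (i, y)).
exact: bigmax_ge_id.
Qed.

(** The quadratic part of [D] is a form in the Gram entries of [psi], each at most [psi_max ^ 2] in
    absolute value; this is where the [L_1] norm enters. *)
Lemma w_of_sqr_le a :
  lam * dotp (w_of P a) (w_of P a) <= psi_max P ^+ 2 / lam * l1norm a ^+ 2.
Proof.
rewrite -(ler_pM2l lambda_gt0).
have -> : lam * (psi_max P ^+ 2 / lam * l1norm a ^+ 2) = l1norm a * (psi_max P ^+ 2 * l1norm a).
  by field.
rewrite dotp_w_of /dpair mulr_sumr /l1norm mulr_suml; apply: ler_sum => i _.
rewrite mulr_sumr mulr_suml; apply: ler_sum => y _.
(* A second use of [dotp_w_of] expands the remaining [w_of] and exposes the Gram entries. *)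
have -> : lam * (dotp (psi P i y) (w_of P a) * a i y)
        = a i y * dpair (fun j z => dotp (psi P j z) (psi P i y)) a.
  by rewrite -dotp_w_of; ring.
apply: le_trans (ler_norm _) _; rewrite normrM ler_wpM2l //.
rewrite /dpair mulr_sumr; apply: le_trans (ler_norm_sum _ _ _) _.
apply: ler_sum => j _; rewrite mulr_sumr; apply: le_trans (ler_norm_sum _ _ _) _.
apply: ler_sum => z _; rewrite normrM ler_wpM2r //.
by apply: dotp_norm_le; exact: psi_sqr_le.
Qed.

(* The function maximized over the dual domain in the smoothed primal objective [J_mu]. *)
Definition smoothed (mu : R) w b : R :=
  lam / 2 * dotp w w + dpair (margin w) b - mu * KL b alpha0.

(* Nesterov's condition [J_mu w <= D a]. *)
Definition excessive_gap (mu : R) w a : Prop :=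
  forall b, simplices b -> smoothed mu w b <= D P a.

(** Only the squared norm is not affine in [w]; its convexity defect is [(1 - t) * t] times the
    squared distance from [w] to [w']. All the entropy is carried by the first term. *)
Lemma smoothed_mix (mu t : R) w w' b : 0 <= t <= 1 ->
  smoothed ((1 - t) * mu) ((1 - t) *: w + t *: w') b
  <= (1 - t) * smoothed mu w b + t * smoothed 0 w' b.
Proof.
case/andP=> t0 t1; rewrite /smoothed !dpair_margin.
have cvx : 0 <= lam / 2 * ((1 - t) * t * dotp (w - w') (w - w')).
  by rewrite !mulr_ge0 ?dotp_ge0 ?subr_ge0 ?invr_ge0 // ltW.
move: cvx; rewrite dotpBl !dotpBr !(dotpDl, dotpDr, dotpZl, dotpZr) (dotpC w' w).
rewrite -subr_ge0 => cvx; rewrite -subr_ge0.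
by apply: le_trans cvx _; rewrite le_eqVlt; apply/orP; left; apply/eqP; field.
Qed.

(** Without smoothing, the inner objective at [w_of P h] is the linearization of [D] at [h], hence a
    link between primal and dual. *)
Lemma smoothed_w_of h b :
  smoothed 0 (w_of P h) b = D P h + dpair (gradD P h) (fun i y => b i y - h i y).
Proof.
have -> : gradD P h = margin (w_of P h) by [].
by rewrite /smoothed dpairBr !dpair_margin DE; field.
Qed.

Hypothesis n_gt0 : (0 < n)%N.
Hypothesis Y_gt0 : (0 < #|Y|)%N.

Let a0_gt0 := @alpha0_gt0 R n Y n_gt0.

Lemma alpha0_simplices : simplices (@alpha0 R n Y).
Proof.
split=> [i y|i]; first exact/ltW/a0_gt0.
rewrite sumr_const -(mulr_natr _ #|_|) invfM -mulrA mulVf ?mulr1 //.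
by rewrite pnatr_eq0 -lt0n.
Qed.

(** Seen as a Bregman projection of the uniform point, the softmax falls under [KL_V]. *)
Lemma alpha_mu_V (mu : R) w :
  alpha_mu P mu w = V alpha0 (scale_dual (- mu^-1) (margin w)).
Proof.
apply/funext => i; apply/funext => y.
have a0 : (n%:R * #|Y|%:R)^-1 != 0 :> R by exact/lt0r_neq0/(a0_gt0 i y).
rewrite /alpha_mu /V /alpha0 -mulr_sumr -mulf_div divff // mul1r.
rewrite /scale_dual /margin mulNr opprK; congr (_ * (_ / _)).
by apply: eq_bigr => z _; rewrite mulNr opprK.
Qed.

Lemma smoothed_alpha_mu (mu : R) w b : 0 < mu -> simplices b ->
  smoothed mu w b
  = smoothed mu w (alpha_mu P mu w) - mu * KL b (alpha_mu P mu w).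
Proof.
move=> mu0 sb; rewrite alpha_mu_V; set s := V _ _.
have := KL_V (scale_dual (- mu^-1) (margin w)) n_gt0 Y_gt0 a0_gt0 sb.
rewrite -/s !dpairZl /smoothed => /(congr1 ( *%R mu)).
have -> x z : mu * (- mu^-1 * x + z) = - x + mu * z by field; rewrite gt_eqF.
have -> x z k : mu * (- mu^-1 * x + z + k) = - x + mu * z + mu * k.
  by field; rewrite gt_eqF.
lra.
Qed.

(** The first dual point maximizes the linearization of [D] at [alpha0] minus [mu_1] times the
    entropy. Since [mu_1] equals [psi_max ^ 2 / lam], Pinsker's inequality covers the quadratic
    error. *)
Lemma excessive_gap_init : 0 < psi_max P ->
  let s := init P in excessive_gap (st_mu s) (st_w s) (st_alpha s).
Proof.
move=> psi0 /= b sb; set mu := lam^-1 * _.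
have mu0 : 0 < mu by rewrite mulr_gt0 ?invr_gt0 ?exprn_gt0.
set g := gradD P alpha0; set s := V _ _.
have ss : simplices s by exact: V_simplices.
have s0 : positive s by exact: V_gt0.
have := KL_V (scale_dual (- mu^-1) g) n_gt0 Y_gt0 a0_gt0 sb.
rewrite -/s !dpairZl => /(congr1 ( *%R mu)).
have -> x z : mu * (- mu^-1 * x + z) = - x + mu * z by field; rewrite gt_eqF.
have -> x z k : mu * (- mu^-1 * x + z + k) = - x + mu * z + mu * k.
  by field; rewrite gt_eqF.
have kb : 0 <= mu * KL b s by rewrite mulr_ge0 ?(ltW mu0) // KL_ge0.
have ks := KL_pinsker n_gt0 ss alpha0_simplices a0_gt0.
have -> : smoothed mu (w_of P alpha0) b = smoothed 0 (w_of P alpha0) b - mu * KL b alpha0.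
  by rewrite /smoothed mul0r subr0.
rewrite smoothed_w_of (D_expand s alpha0) -/g !dpairBr.
have := w_of_sqr_le (fun i y => s i y - alpha0 i y).
have := ler_wpM2l (ltW mu0) ks.
have -> : psi_max P ^+ 2 / lam = mu by rewrite /mu mulrC.
move: kb; move: (dpair g b) (dpair g s) (dpair g alpha0) (KL b alpha0) (KL b s).
move: (KL s alpha0) (l1norm _) (dotp _ _) (D P alpha0) => *.
lra.
Qed.

(* [(1 - t) mu / t ^ 2] must dominate the Lipschitz constant [psi_max ^ 2 / lam]
   of the gradient of [D]. *)
Lemma excessive_gap_step (k : nat) (s : @state R n p Y) : 0 < st_mu s ->
  @tau R k ^+ 2 * (psi_max P ^+ 2 / lam) <= (1 - @tau R k) * st_mu s ->
  excessive_gap (st_mu s) (st_w s) (st_alpha s) ->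
  let s' := step P k s in excessive_gap (st_mu s') (st_w s') (st_alpha s').
Proof.
case: s => mu w a /= mu0; set t := @tau R k => tmu gap b sb.
have t01 : 0 < t < 1.
  rewrite /t /tau divr_gt0 ?ltr0n ?addn_gt0 ?orbT //=.
  by rewrite ltr_pdivrMr ?mul1r ?ltr_nat ?ltr0n ?addn_gt0 ?orbT // addn3.
case/andP: t01 => t0 t1.
set s := alpha_mu P mu w; set h := mix_dual t a s; set g := gradD P h.
set nu := (1 - t) * mu.
have nu0 : 0 < nu by rewrite mulr_gt0 ?subr_gt0.
set r := V s _; set a' := mix_dual t a r.
have ss : simplices s by rewrite /s alpha_mu_V; exact: V_simplices.
have s0 : positive s by rewrite /s alpha_mu_V; exact: V_gt0.
have rs : simplices r by exact: V_simplices.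
have r0 : positive r by exact: V_gt0.
apply: le_trans (smoothed_mix _ _ _ _ _) _; first by rewrite !ltW.
rewrite smoothed_w_of -/g.
(* The gap hypothesis is used at the optimizer [s] only, then concavity replaces [D P a] by the
   linearization at [h]; the entropy shortfall of [b] is kept. *)
have lin : smoothed mu w b <= D P h + dpair g (fun i y => a i y - h i y) - mu * KL b s.
  rewrite smoothed_alpha_mu // lerD2r; apply: le_trans (gap _ ss) _.
  rewrite (D_expand a h) gerBl mulr_ge0 ?dotp_ge0 // divr_ge0 // ltW //.
have t1' : 0 <= 1 - t by rewrite subr_ge0 ltW.
apply: le_trans (lerD (ler_wpM2l t1' lin) (lexx _)) _.
(* [a'] and [h] share the component [(1 - t) a], so the quadratic error carries the factor
   [t ^ 2]. *)
have a'h : (fun i y => a' i y - h i y) = scale_dual t (fun i y => r i y - s i y).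
  by apply/funext => i; apply/funext => y; rewrite /a' /h /mix_dual /scale_dual; ring.
have Da' : D P h + t * dpair g (fun i y => r i y - s i y) - nu * KL r s <= D P a'.
  rewrite (D_expand a' h) a'h -/g dpairZr.
  have := w_of_sqr_le (scale_dual t (fun i y => r i y - s i y)).
  have -> : l1norm (scale_dual t (fun i y => r i y - s i y))
          = t * l1norm (fun i y => r i y - s i y).
    rewrite /l1norm !mulr_sumr; apply: eq_bigr => i _.
    rewrite !mulr_sumr; apply: eq_bigr => y _.
    by rewrite /scale_dual normrM (gtr0_norm t0).
  have := ler_wpM2r (sqr_ge0 (l1norm (fun i y => r i y - s i y))) tmu.
  have := ler_wpM2l (ltW nu0) (KL_pinsker n_gt0 rs ss s0).
  rewrite -/nu.
  move: (l1norm _) (dotp _ _) (KL r s) (dpair g _) (D P h) => *.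
  lra.
apply: le_trans Da'.
(* [r] maximizes [t * dpair g x - nu * KL x s] over the dual domain, which allows [b] to be replaced
   by [r]. *)
have := KL_V (scale_dual (- t / nu) g) n_gt0 Y_gt0 s0 sb.
rewrite -/r !dpairZl => /(congr1 ( *%R nu)).
have -> x z : nu * (- t / nu * x + z) = - (t * x) + nu * z by field; rewrite gt_eqF.
have -> x z c : nu * (- t / nu * x + z + c) = - (t * x) + nu * z + nu * c.
  by field; rewrite gt_eqF.
have : 0 <= nu * KL b r by rewrite mulr_ge0 ?(ltW nu0) // KL_ge0.
(* The linear terms collapse: [(1 - t) (a - h) + t (b - h) = t (b - s)]. *)
rewrite !dpairBr (_ : dpair g h = (1 - t) * dpair g a + t * dpair g s); last exact: dpair_mix.
rewrite /nu; move: (dpair g b) (dpair g s) (dpair g a) (dpair g r) (D P h).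
move: (KL b s) (KL b r) (KL r s) => *.
lra.
Qed.

(* [tau_k = 2 / (k + 3)] makes [mu_(k+1) = (1 - tau_k) mu_k] telescope. *)
Lemma st_mu_iterate (k : nat) :
  st_mu (iterate P k.+1) = 6 / ((k + 2)%:R * (k + 3)%:R) * (psi_max P ^+ 2 / lam).
Proof.
elim: k => [|k IHk]; first by rewrite /iterate /=; field.
have -> : iterate P k.+2 = step P k.+1 (iterate P k.+1) by [].
case: (iterate P k.+1) IHk => mu w a /= ->; rewrite /tau !natrD -[k.+1%:R]natr1.
have k0 : 0 <= k%:R :> R by [].
by field; rewrite lam_neq0 /=; do ?[apply/andP; split]; rewrite gt_eqF //; lra.
Qed.

Lemma excessive_gap_iterate (k : nat) : 0 < psi_max P -> (1 <= k)%N ->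
  excessive_gap (6 / ((k + 1)%:R * (k + 2)%:R) * (psi_max P ^+ 2 / lam))
    (w_seq P k) (alpha_seq P k).
Proof.
move=> psi0; case: k => // k _.
have L0 : 0 < psi_max P ^+ 2 / lam by rewrite divr_gt0 ?exprn_gt0.
rewrite !addSnnS -st_mu_iterate /w_seq /alpha_seq.
elim: k => [|k IHk]; first exact: excessive_gap_init.
have -> : iterate P k.+2 = step P k.+1 (iterate P k.+1) by [].
apply: excessive_gap_step => //; rewrite st_mu_iterate.
  by rewrite mulr_gt0 // divr_gt0 // mulr_gt0 // ltr0n addn_gt0 orbT.
rewrite (mulrA (1 - _)) ler_pM2r // /tau !natrD -[k.+1%:R]natr1.
have k0 : 0 <= k%:R :> R by [].
rewrite -subr_ge0.
(* The slack in the step-size condition is computed exactly and is visibly nonnegative. *)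
have -> : (1 - 2 / (k%:R + 1 + 3)) * (6 / ((k%:R + 2) * (k%:R + 3))) - (2 / (k%:R + 1 + 3)) ^+ 2
   = (2 * k%:R + 12) / ((k%:R + 3) * (k%:R + 4) ^+ 2) :> R.
  by field; do ?[apply/andP; split]; rewrite gt_eqF //; lra.
by rewrite divr_ge0 ?mulr_ge0 ?exprn_ge0 //; lra.
Qed.

(** Completing the square: without its entropy term, the smoothed objective at [b] exceeds [D P b]
    by [lam / 2] times the squared distance from [w] to [w_of P b]. *)
Lemma dual_gap_le (mu : R) w a b : excessive_gap mu w a -> simplices b ->
  D P b <= D P a + mu * KL b alpha0.
Proof.
move=> gap sb; have := gap _ sb; rewrite /smoothed dpair_margin (DE b).
have : 0 <= lam / 2 * dotp (w - w_of P b) (w - w_of P b).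
  by rewrite mulr_ge0 ?dotp_ge0 // divr_ge0 // ltW.
rewrite dotpBl !dotpBr (dotpC _ w); lra.
Qed.

(* The smoothed objective is bounded below at the vertex of the dual domain that
   puts all the weight of each sample on a label of maximal margin. *)
Lemma duality_gap_le (mu : R) w a : excessive_gap mu w a ->
  J P w <= D P a + mu * ln #|Y|%:R.
Proof.
move=> gap.
(* The default value of the maximum is the margin of the true label, so the maximum is attained in
   every case. *)
have best i : {y | \big[Num.max/margin w i (label P i)]_z margin w i z = margin w i y}.
  pose m := \big[Num.max/margin w i (label P i)]_z margin w i z.
  suff : exists y, m == margin w i y.
    by case/sigW=> y /eqP my; exists y.
  rewrite /m; elim/big_ind: _ => [|x y [u /eqP->] [v /eqP->]|y _].
  - by exists (label P i).
  - by case: (leP (margin w i u) (margin w i v)) => _; [exists v|exists u].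
  - by exists y.
pose ystar i := sval (best i).
pose b : @dual R n Y := fun i y => if y == ystar i then n%:R^-1 else 0.
have n0 : 0 < n%:R :> R by rewrite ltr0n.
have Y0 : 0 < #|Y|%:R :> R by rewrite ltr0n.
have sumb i (F : Y -> R) : \sum_y (if y == ystar i then F y else 0) = F (ystar i).
  by rewrite -big_mkcond big_pred1_eq.
have sb : simplices b.
  split=> [i y|i]; first by rewrite /b; case: ifP => // _; rewrite invr_ge0 ltW.
  by rewrite /b sumb.
have := gap b sb; rewrite /smoothed.
have -> : KL b alpha0 = ln #|Y|%:R.
  transitivity (\sum_(i < n) n%:R^-1 * ln (#|Y|%:R : R)).
    apply: eq_bigr => i _; rewrite -[RHS](sumb i (fun=> _)); apply: eq_bigr => y _.
    rewrite /b; case: ifP => _; last by rewrite mul0r.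
    by congr (_ * ln _); rewrite /alpha0; field; rewrite !gt_eqF.
  by rewrite sumr_const card_ord -mulrnAl -(mulr_natr n%:R^-1) mulVf ?mul1r // gt_eqF.
have -> : dpair (margin w) b
    = n%:R^-1 * \sum_(i < n) \big[Num.max/margin w i (label P i)]_y margin w i y.
  rewrite mulr_sumr; apply: eq_bigr => i _.
  rewrite (svalP (best i)) -/(ystar i) -[RHS](sumb i (fun y => n%:R^-1 * margin w i y)).
  by apply: eq_bigr => y _; rewrite /b; case: ifP => _; rewrite ?mulr0 // mulrC.
have -> : J P w = lam / 2 * dotp w w
    + n%:R^-1 * \sum_(i < n) \big[Num.max/margin w i (label P i)]_y margin w i y.
  rewrite /J enorm_sqr; congr (_ + _ * _); apply: eq_bigr => i _.
  rewrite /margin (dotpC w); apply: eq_bigr => y _; by rewrite dotpC.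
by rewrite lerBlDr.
Qed.

End ExcessiveGap.

(** * Iteration counts and conclusion *)

Lemma maxD_le (R : realType) (n p : nat) (X : Type) (Y : finType)
    (P : m3n R n p X Y) (astar : dual) :
  is_argmaxD P astar -> maxD P <= D P astar.
Proof.
case=> Sa ub; apply: ge_sup; first by exists (D P astar), astar.
by move=> _ [b Sb <-]; exact: ub.
Qed.

Lemma lt_of_quadratic_rate (R : realType) (g c m lam eps : R) (k : nat) :
  0 < lam -> 0 < m -> 0 < eps ->
  g <= 6 * c / ((k + 1)%:R * (k + 2)%:R) * (m ^+ 2 / lam) ->
  2 + m * Num.sqrt (6 * c / (lam * eps)) <= k%:R -> g < eps.
Proof.
move=> lam0 m0 eps0 gle; rewrite -lerBrDl => kge.
have k0 : 0 <= k%:R :> R by [].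
have den0 : 0 < (k%:R + 1) * (k%:R + 2) :> R by rewrite mulr_gt0 //; lra.
apply: le_lt_trans gle _; rewrite !natrD.
rewrite mulrAC ltr_pdivrMr //.
(* For [c <= 0] the bound on [g] is already nonpositive; otherwise the argument of the square root
   is nonnegative and squaring is faithful. *)
have [c0|c0] := leP c 0.
  apply: (@le_lt_trans _ _ 0); last by rewrite mulr_gt0.
  by rewrite mulr_le0_ge0 ?divr_ge0 ?sqr_ge0 ?(ltW lam0) // mulr_ge0_le0.
have q0 : 0 <= 6 * c / (lam * eps) by rewrite divr_ge0 ?mulr_ge0 // ltW.
have s0 : 0 <= m * Num.sqrt (6 * c / (lam * eps)) by rewrite mulr_ge0 ?sqrtr_ge0 // ltW.
have : (m * Num.sqrt (6 * c / (lam * eps))) ^+ 2 <= (k%:R - 2) ^+ 2.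
  by rewrite ler_sqr ?nnegrE // (le_trans s0).
rewrite exprMn sqr_sqrtr // => le1.
have -> : 6 * c * (m ^+ 2 / lam) = eps * (m ^+ 2 * (6 * c / (lam * eps))).
  by field; rewrite !gt_eqF.
(* The hypothesis forces [k >= 2], whence [(k - 2) ^ 2 < (k + 1) (k + 2)]. *)
rewrite ltr_pM2l //; apply: le_lt_trans le1 _; nra.
Qed.

Theorem mainTheorem3 (R : realType) (n p : nat) (X : Type) (Y : finType)
    (P : m3n R n p X Y)
    (n_gt0 : (0 < n)%N) (lambda_gt0 : 0 < lambda P)
    (psi_gt0 : 0 < psi_max P) :
  [/\ forall k : nat, (1 <= k)%N ->
        J P (w_seq P k) - D P (alpha_seq P k)
        <= 6 * ln #|Y|%:R / ((k + 1)%:R * (k + 2)%:R)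
           * (psi_max P ^+ 2 / lambda P),
      forall astar : dual, is_argmaxD P astar ->
        forall k : nat, (1 <= k)%N ->
          maxD P - D P (alpha_seq P k)
          <= 6 * KL astar alpha0 / ((k + 1)%:R * (k + 2)%:R)
             * (psi_max P ^+ 2 / lambda P),
      forall eps : R, 0 < eps ->
        forall k : nat, (1 <= k)%N ->
          2 + psi_max P * Num.sqrt (6 * ln #|Y|%:R / (lambda P * eps)) <= k%:R ->
          J P (w_seq P k) - D P (alpha_seq P k) < eps
    & forall astar : dual, is_argmaxD P astar ->
        forall eps : R, 0 < eps ->
          forall k : nat, (1 <= k)%N ->
            2 + psi_max P * Num.sqrt (6 * KL astar alpha0 / (lambda P * eps))
              <= k%:R ->
            maxD P - D P (alpha_seq P k) < eps].
Proof.
have Y_gt0 : (0 < #|Y|)%N.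
  by apply/card_gt0P; exists (label P (Ordinal n_gt0)).
have gap k (k1 : (1 <= k)%N) :=
  excessive_gap_iterate lambda_gt0 n_gt0 Y_gt0 psi_gt0 k1.
have Jgap (k : nat) : (1 <= k)%N -> J P (w_seq P k) - D P (alpha_seq P k)
    <= 6 * ln #|Y|%:R / ((k + 1)%:R * (k + 2)%:R) * (psi_max P ^+ 2 / lambda P).
  move=> k1; rewrite lerBlDl; apply: le_trans (duality_gap_le n_gt0 Y_gt0 (gap k k1)) _.
  by rewrite lerD2l le_eqVlt; apply/orP; left; apply/eqP; ring.
have Dgap (astar : dual) : is_argmaxD P astar -> forall k : nat, (1 <= k)%N ->
    maxD P - D P (alpha_seq P k)
    <= 6 * KL astar alpha0 / ((k + 1)%:R * (k + 2)%:R) * (psi_max P ^+ 2 / lambda P).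
  move=> max k k1; rewrite lerBlDl; apply: le_trans (maxD_le max) _.
  have [/Sn_simplices Sa _] := max.
  apply: le_trans (dual_gap_le lambda_gt0 (gap k k1) Sa) _.
  by rewrite lerD2l le_eqVlt; apply/orP; left; apply/eqP; ring.
split=> // [eps eps0 k k1|astar max eps eps0 k k1].
  exact: lt_of_quadratic_rate (Jgap k k1).
exact: lt_of_quadratic_rate (Dgap astar max k k1).
Qed.
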